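(* Let $n\ge 0$ be an integer and let $J\subset\mathbb{R}$ be an interval. For every triple $(\psi,f,g)$ of complex-valued functions of class $\mathcal{C}^n$ on $J$, one has on $J$ $$\frac{1}{n!}D^{n-1}\left(\psi^{n}D(fg)\right)=\sum_{k=0}^{n}\frac{1}{k!}D^{k-1}\left(\psi^{k}D(f)\right)\frac{1}{(n-k)!}D^{n-k-1}\left(\psi^{n-k}D(g)\right).$$ More generally, for every integer $p\ge 2$ and every system $(\psi,f_1,\ldots,f_p)$ of complex-valued functions of class $\mathcal{C}^n$ on $J$, $$\frac{1}{n!}D^{n-1}\left(\psi^{n}D(f_1\cdots f_p)\right)=\sum_{\alpha_1+\cdots+\alpha_p=n}\left(\prod_{j=1}^{p}\frac{1}{\alpha_j!}D^{\alpha_j-1}\left(\psi^{\alpha_j}D(f_j)\right)\right),$$ where the sum is over all $(\alpha_1,\ldots,\alpha_p)\in\mathbb{N}^p$ (with $0\in\mathbb{N}$) such that $\alpha_1+\cdots+\alpha_p=n$.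
   Context: $D$ denotes differentiation of complex-valued functions on a real interval and $D^k$ its $k$-th iterate. Convention: for $m=0$ the expression $D^{m-1}\left(\psi^{m}D(f)\right)$ means the function $f$ itself. All intervals contain at least two distinct points. *)

(* Defs.v *)
From HB Require Import structures.
From mathcomp Require Import all_boot all_order all_algebra.
From mathcomp Require Import complex.
From mathcomp Require Import all_classical all_reals all_analysis.
Set Implicit Arguments.
Unset Strict Implicit.
Unset Printing Implicit Defensive.
Import Order.TTheory GRing.Theory Num.Theory.
Import numFieldNormedType.Exports.
Local Open Scope classical_set_scope.
Local Open Scope complex_scope.
Local Open Scope ring_scope.

(* Functions on [J] are represented by total functions [R -> R[i]] of which only
   the values on [J] matter. [R[i]^o] is [R[i]] with its usual topology, given
   by the modulus. *)

Definition diff_quotient (R : realType) (f : R -> R[i]) (x y : R) : R[i]^o :=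
  (f y - f x) / (y - x)%:C.

(* The limits are taken along [y] in [J], [y != x]; they are therefore one-sided
   at an end point of [J] that belongs to [J]. *)
Definition derivable_on (R : realType) (J : set R) (f : R -> R[i]) (x : R) :
    Prop :=
  cvg (diff_quotient f x y @[y --> within J x^']).

Definition derive_on (R : realType) (J : set R) (f : R -> R[i]) : R -> R[i] :=
  fun x => lim (diff_quotient f x y @[y --> within J x^']).

Definition class_C (R : realType) (n : nat) (J : set R) (f : R -> R[i]) : Prop :=
  (forall k, (k < n)%N ->
     forall x, J x -> derivable_on J (iter k (derive_on J) f) x) /\
  {within J, continuous (iter n (derive_on J) f : R -> R[i]^o)}.

(* D^(m-1) (psi^m D f), read as [f] when [m = 0]. *)
Definition D_pred (R : realType) (J : set R) (psi : R -> R[i]) (m : nat)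
    (f : R -> R[i]) : R -> R[i] :=
  if m is k.+1
  then iter k (derive_on J) (fun x => psi x ^+ m * derive_on J f x)
  else f.

(* Main.v *)
Require Import Defs.
From HB Require Import structures.
From mathcomp Require Import all_boot all_order all_algebra.
From mathcomp Require Import complex.
From mathcomp Require Import all_classical all_reals all_analysis.
From mathcomp Require Import ring.
Set Implicit Arguments.
Unset Strict Implicit.
Unset Printing Implicit Defensive.
Import Order.TTheory GRing.Theory Num.Theory.
Import numFieldNormedType.Exports.
Local Open Scope classical_set_scope.
Local Open Scope complex_scope.
Local Open Scope ring_scope.

(** The numbers [A_n f = D^(n-1) (psi^n D f) / n!], with [A_0 f = f] ([A_coef]),
    are the Taylor coefficients, in [t], of [f (phi t x)], where [phi] solves
    Lagrange's implicit equation [phi = x + t psi (phi)]; the theorem is the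
    multiplicativity of [f |-> f (phi)]. No power series has to converge,
    because the same idea can be carried out on coefficients, with the companion
    numbers [B_n u = D^n (psi^n u) / n!] ([B_coef]), the coefficients of
    [u (phi) D phi]. Write [*] for the convolution of sequences. Three relations
    link the two families:

    - [(n+1) A_(n+1) f = B_n (psi D f)]   ([A_coefS]);
    - [D (A_n f) = B_n (D f)]             ([has_deriv_A_coef]);
    - [D (B_n (psi u)) = (n+1) B_(n+1) u] ([has_deriv_B_coef]).

    The core is [B_coefM]: [B (f u) = A f * B u]. It is proved by strong
    induction on the degree. Differentiating the formula of degree [n] for the
    pair [f], [psi u] gives the formula of degree [n+1] for [f], [u], provided
    that [B (D f) * B (psi u) = B (psi D f) * B u] in degree [n]; by the
    induction hypothesis both sides are [A psi * B (D f) * B u].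
    Then [A_coefM], that is [A (f g) = A f * A g], follows from
    [(n+1) A_(n+1) (f g) = B_n (g (psi D f)) + B_n (f (psi D g))].

    Each step consumes exactly one derivative, so [C^n] data suffice for the
    identity of degree [n]. For several factors, [A_0 f, ..., A_n f] are read as
    the coefficients of a polynomial, so that the identity equates the
    coefficient of degree [n] of a product of polynomials with its multinomial
    expansion. *)

(** * Convolution of sequences *)

Section Convolution.
Context {A : comNzRingType}.
Implicit Types (a b c : nat -> A) (n : nat).

Definition conv a b n : A := \sum_(k < n.+1) a k * b (n - k)%N.

Lemma eq_conv a a' b b' n :
  (forall k, (k <= n)%N -> a k = a' k) -> (forall k, (k <= n)%N -> b k = b' k) ->
  conv a b n = conv a' b' n.
Proof.
move=> aa' bb'; apply: eq_bigr => k _.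
by rewrite aa' -1?ltnS // bb' // leq_subr.
Qed.

(** Convolution is polynomial multiplication once the sequences are cut off
    beyond the degree considered; its algebraic laws are inherited from the ring
    of polynomials. *)
Lemma conv_coefM a b N n : (n <= N)%N ->
  conv a b n = ((\poly_(i < N.+1) a i) * (\poly_(i < N.+1) b i))`_n.
Proof.
move=> nN; rewrite coefM; apply: eq_bigr => k _.
rewrite !coef_poly !ltnS (leq_trans _ nN) ?(leq_trans _ nN) ?leq_subr //.
by rewrite -ltnS.
Qed.

Lemma convC a b n : conv a b n = conv b a n.
Proof. by rewrite !(conv_coefM _ _ (leqnn n)) mulrC. Qed.

Lemma convA a b c n : conv a (conv b c) n = conv (conv a b) c n.
Proof.
pose P (d : nat -> A) := \poly_(i < n.+1) d i.
have convP d e k : (k <= n)%N -> conv d e k = (P d * P e)`_k by exact: conv_coefM.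
transitivity ((P a * (P b * P c))`_n).
  rewrite coefM; apply: eq_bigr => k _.
  by rewrite coef_poly ltn_ord convP ?leq_subr.
rewrite mulrA coefM; apply: eq_bigr => k _.
by rewrite [(P c)`_ _]coef_poly ltnS leq_subr -convP // -ltnS.
Qed.

(** The Leibniz rule for formal power series, which turns an identity between
    convolutions of degree [n+1] into one of degree [n]. *)
Lemma conv_derivM a b n : n.+1%:R * conv a b n.+1 =
  conv (fun k => k.+1%:R * a k.+1) b n + conv a (fun k => k.+1%:R * b k.+1) n.
Proof.
rewrite (conv_coefM _ _ (leqnn _)) mulr_natl -coef_deriv derivM coefD !coefM.
congr (_ + _); apply: eq_bigr => k _; rewrite coef_deriv !coef_poly !ltnS;
  have kn : (k <= n)%N by rewrite -ltnS.
  by rewrite kn (leq_trans (leq_subr _ _)) // mulr_natl.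
by rewrite leq_subr (leq_trans kn) // mulr_natl.
Qed.

(** Expanding the product by distributivity, a choice of one monomial in each
    factor contributes to degree [n] exactly when its exponents add up to [n]. *)
Lemma coef_prod_poly p n (a : 'I_p -> nat -> A) :
  (\prod_(j < p) \poly_(i < n.+1) a j i)`_n =
  \sum_(alpha : {ffun 'I_p -> 'I_n.+1} | (\sum_(j < p) alpha j == n)%N)
    \prod_(j < p) a j (alpha j).
Proof.
under eq_bigr do rewrite poly_def.
rewrite bigA_distr_bigA /= coef_sum [RHS]big_mkcond; apply: eq_bigr => alpha _.
rewrite scaler_prod prodrXr coefZ coefXn eq_sym.
by case: eqP => _; rewrite ?mulr1 ?mulr0.
Qed.

End Convolution.

(** * Derivatives and functions of class C^n on an interval *)

Lemma increment_mul (A : comPzRingType) (a b c d h : A) :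
  (a * b - c * d) * h = (a - c) * h * b + c * ((b - d) * h).
Proof. by ring. Qed.

Section Calculus.
Context {R : realType} {J : set R}.
Hypothesis J_interval : is_interval J.
Hypothesis J_two_points : exists a b : R, [/\ J a, J b & a <> b].
Implicit Types (f g h u v psi : R -> R[i]) (x y : R) (m n k : nat).

(** The relational form of [derivable_on] and [derive_on], which needs no choice
    of a limit. *)
Definition has_deriv f x (l : R[i]) : Prop :=
  diff_quotient f x y @[y --> within J x^'] --> (l : R[i]^o).

(** This is where the shape of [J] matters: as [J] is an interval with a second
    point [z], every point strictly between [x] and [z] is in [J], so [x] can be
    approached inside [J], and limits are unique. *)
Lemma within_dnbhs_proper x : J x -> ProperFilter (within J x^').
Proof.
move=> Jx; apply: Build_ProperFilter_ex => B JB.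
have [z Jz zx] : exists2 z, J z & z != x.
  have [a [b [Ja Jb ab]]] := J_two_points.
  have [ax|ax] := eqVneq a x; last by exists a.
  by exists b => //; apply/eqP => bx; apply: ab; rewrite ax bx.
case: (ltgtP x z) zx => // [xz|zx] _.
- have near_right : \forall y \near x^'+, [/\ J y -> B y, y < z & x < y].
    near=> y; split; [|by near: y; exact: nbhs_right_lt|by near: y; exact: nbhs_right_gt].
    have yx : y != x by near: y; exact: nbhs_right_neq.
    by move: yx; near: y; apply: cvg_within; exact: JB.
  have [y [By yz xy]] := @filter_ex _ _ (at_right_proper_filter x) _ near_right.
  by exists y; apply: By; apply: (J_interval Jx Jz); rewrite !ltW.
- have near_left : \forall y \near x^'-, [/\ J y -> B y, z < y & y < x].
    near=> y; split; [|by near: y; exact: nbhs_left_gt|by near: y; exact: nbhs_left_lt].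
    have yx : y != x by near: y; exact: nbhs_left_neq.
    by move: yx; near: y; apply: cvg_within; exact: JB.
  have [y [By yz xy]] := @filter_ex _ _ (at_left_proper_filter x) _ near_left.
  by exists y; apply: By; apply: (J_interval Jz Jx); rewrite !ltW.
Unshelve. all: by end_near. Qed.

Lemma has_deriv_derive_on f x l : J x -> has_deriv f x l -> derive_on J f x = l.
Proof.
move=> Jx fl; have ? := within_dnbhs_proper Jx.
by apply: cvg_lim fl; exact: norm_hausdorff.
Qed.

Lemma derivable_onP f x : derivable_on J f x <-> has_deriv f x (derive_on J f x).
Proof. by split=> [//|fl]; apply/cvg_ex; exists (derive_on J f x). Qed.

Lemma has_deriv_derivable f x l : has_deriv f x l -> derivable_on J f x.
Proof. by move=> fl; apply/cvg_ex; exists l. Qed.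

Lemma has_deriv_ext f g x l : J x -> (forall y, J y -> f y = g y) ->
  has_deriv f x l -> has_deriv g x l.
Proof.
move=> Jx fg; apply: cvg_trans; apply: near_eq_cvg.
by apply: filterS (withinT J _) => y Jy; rewrite /diff_quotient !fg.
Qed.

Lemma cvg_real_complex_sub x : ((y - x)%:C : R[i]^o) @[y --> x] --> (0 : R[i]^o).
Proof.
apply/(@cvgrPdist_lt _ R[i]^o) => e e0.
have eE : e = (complex.Re e)%:C.
  by move: e0; case: e => a b; rewrite ltcE /= => /andP[/eqP -> _].
have re0 : 0 < complex.Re e by rewrite -ltcR -eE.
near=> y.
rewrite sub0r normrN eE normc_def /= expr0n /= addr0 sqrtr_sqr ltcR distrC.
by near: y; exact: cvgr_dist_lt.
Unshelve. all: by end_near. Qed.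

Lemma cvg_dnbhs_within f x (l : R[i]^o) : J x ->
  (f y : R[i]^o) @[y --> within J x^'] --> l ->
  f x = l -> (f y : R[i]^o) @[y --> within J (nbhs x)] --> l.
Proof.
move=> Jx fl fxl V Vl; have := fl _ Vl.
rewrite !nbhs_simpl /within /= /dnbhs /within /= => H.
near=> y => Jy; have [->|yx] := eqVneq y x.
  by rewrite fxl; exact: nbhs_singleton.
by move: yx Jy; near: y.
Unshelve. all: by end_near. Qed.

Lemma has_deriv_continuous f x l : J x -> has_deriv f x l ->
  (f y : R[i]^o) @[y --> within J (nbhs x)] --> (f x : R[i]^o).
Proof.
move=> Jx fl; apply: (cvg_dnbhs_within Jx _ (erefl (f x))).
have xy0 : ((y - x)%:C : R[i]^o) @[y --> within J x^'] --> (0 : R[i]^o).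
  by apply: cvg_within_filter; apply: cvg_within_filter; exact: cvg_real_complex_sub.
have FF : Filter (within J x^') by exact: within_filter.
(* f y = (f y - f x) / (y - x) * (y - x) + f x *)
have := cvgD (FF:=FF) (cvgM (FF:=FF) fl xy0) (@cvg_cst _ (f x : R[i]^o) _ _ FF).
rewrite mulr0 add0r; apply: cvg_trans; apply: near_eq_cvg.
have : within J x^' [set y | y != x].
  have neq : x^' [set y | y != x] by exact: withinT.
  by apply: filterS neq => y.
apply: filterS => y /= yx.
rewrite /diff_quotient /= !fctE /= divfK ?subrK //.
by apply: contra yx => /eqP[] /eqP; rewrite subr_eq0.
Qed.

Lemma has_derivD f g x a b : has_deriv f x a -> has_deriv g x b ->
  has_deriv (fun y => f y + g y) x (a + b).
Proof.
rewrite /has_deriv => fa gb; have FF : Filter (within J x^') by exact: within_filter.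
have -> : diff_quotient (fun y => f y + g y) x =
          diff_quotient f x + diff_quotient g x.
  by apply/funext => y; rewrite /diff_quotient !fctE -mulrDl opprD addrACA.
exact: (cvgD (FF:=FF) fa gb).
Qed.

Lemma has_derivM f g x a b : J x -> has_deriv f x a -> has_deriv g x b ->
  has_deriv (fun y => f y * g y) x (a * g x + f x * b).
Proof.
rewrite /has_deriv => Jx fa gb; have FF : Filter (within J x^') by exact: within_filter.
have gx : (g y : R[i]^o) @[y --> within J x^'] --> (g x : R[i]^o).
  move=> V Vgx; have : within J (nbhs x) (g @^-1` V).
    exact: (has_deriv_continuous Jx gb).
  rewrite /within /= => gV; apply: (@filterS _ (nbhs x)) gV => y Vy _.
  exact: Vy.
have -> : diff_quotient (fun y => f y * g y) x =
    ((diff_quotient f x \* (g : R -> R[i]^o)) +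
     ((fun=> f x : R[i]^o) \* diff_quotient g x)).
  apply/funext => y; rewrite /diff_quotient !fctE /=.
  exact: increment_mul.
exact: (cvgD (FF:=FF) (cvgM (FF:=FF) fa gx)
  (cvgM (FF:=FF) (@cvg_cst _ (f x : R[i]^o) _ _ FF) gb)).
Qed.

Lemma has_deriv_cst c x : has_deriv (fun=> c) x 0.
Proof.
apply: cvg_near_cst; apply: nearW => y.
by rewrite /diff_quotient subrr mul0r.
Qed.

Lemma class_C0P f : class_C 0 J f <->
  forall x, J x -> (f y : R[i]^o) @[y --> within J (nbhs x)] --> (f x : R[i]^o).
Proof.
by rewrite -(subspace_continuousP J (f : R -> R[i]^o)); split=> [[]|].
Qed.

(** All closure properties of [class_C] below are proved by induction on [n]
    through this recursive description. *)
Lemma class_CSP n f : class_C n.+1 J f <->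
  (forall x, J x -> derivable_on J f x) /\ class_C n J (derive_on J f).
Proof.
rewrite /class_C -iterSr; split=> [[df cf]|[d1 [df cf]]].
  split; first exact: (df 0%N).
  split; last exact: cf.
  by move=> k kn x Jx; rewrite -iterSr; exact: df.
split; last exact: cf.
by move=> [|k] kn x Jx; [exact: d1|rewrite iterSr; exact: df].
Qed.

(** Derivatives on [J] are known only up to equality on [J]; this family of
    lemmas transports them along such equalities. *)
Lemma derive_on_ext f g x : J x -> (forall y, J y -> f y = g y) ->
  derive_on J f x = derive_on J g x.
Proof.
move=> Jx fg; have FF : Filter (within J x^') by exact: within_filter.
have near_eq : {near within J x^', diff_quotient f x =1 diff_quotient g x}.
  by apply: filterS (withinT J _) => y Jy; rewrite /diff_quotient !fg.
suff fgE : (diff_quotient f x y @[y --> within J x^'])%classic =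
           (diff_quotient g x y @[y --> within J x^'])%classic.
  by rewrite /derive_on fgE.
apply/seteqP; split; apply: near_eq_cvg => //.
by apply: filterS near_eq => y ->.
Qed.

Lemma iter_derive_on_ext k f g x : J x -> (forall y, J y -> f y = g y) ->
  iter k (derive_on J) f x = iter k (derive_on J) g x.
Proof.
elim: k f g x => [|k IHk] f g x Jx fg; first exact: fg.
rewrite !iterSr; apply: IHk => // y Jy; exact: derive_on_ext.
Qed.

Lemma class_C_ext n f g : (forall y, J y -> f y = g y) ->
  class_C n J f -> class_C n J g.
Proof.
elim: n f g => [|n IHn] f g fg.
  rewrite !class_C0P => fC x Jx; rewrite -fg //; apply: cvg_trans (fC x Jx).
  apply: near_eq_cvg; apply: filterS (withinT J _) => y Jy.
  exact: fg.
rewrite !class_CSP => -[df Cf]; split=> [x Jx|].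
  apply: has_deriv_derivable.
  by apply: (has_deriv_ext Jx fg); apply/derivable_onP/df.
by apply: IHn Cf => y Jy; exact: derive_on_ext.
Qed.

Lemma class_CW n f : class_C n.+1 J f -> class_C n J f.
Proof.
elim: n f => [|n IHn] f; rewrite class_CSP => -[df Cf].
  apply/class_C0P => x Jx; apply: has_deriv_continuous => //.
  exact/derivable_onP/df.
by apply/class_CSP; split; [exact: df|exact: IHn].
Qed.

Lemma class_C_le m n f : (m <= n)%N -> class_C n J f -> class_C m J f.
Proof.
elim: n => [|n IHn]; first by rewrite leqn0 => /eqP ->.
by rewrite leq_eqVlt => /orP[/eqP ->|mn] Cf; [exact: Cf|exact: IHn (class_CW Cf)].
Qed.

Lemma class_C_has_deriv n f x : class_C n.+1 J f -> J x ->
  has_deriv f x (derive_on J f x).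
Proof. by rewrite class_CSP => -[df _] Jx; apply/derivable_onP/df. Qed.

Lemma class_C_derive_on n f : class_C n.+1 J f -> class_C n J (derive_on J f).
Proof. by rewrite class_CSP => -[]. Qed.

Lemma class_CS_intro n f (f' : R -> R[i]) :
  (forall x, J x -> has_deriv f x (f' x)) -> class_C n J f' -> class_C n.+1 J f.
Proof.
move=> ff' Cf'; apply/class_CSP; split=> [x Jx|].
  exact: has_deriv_derivable (ff' x Jx).
apply: class_C_ext Cf' => x Jx; apply/esym.
exact: has_deriv_derive_on (ff' x Jx).
Qed.

Lemma class_C_cst n (c : R[i]) : class_C n J (fun=> c).
Proof.
elim: n c => [|n IHn] c; first by apply/class_C0P => x Jx; exact: cvg_cst.
apply: (class_CS_intro (f' := fun=> 0)); last exact: IHn.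
by move=> x _; exact: has_deriv_cst.
Qed.

Lemma class_CD n f g : class_C n J f -> class_C n J g ->
  class_C n J (fun y => f y + g y).
Proof.
elim: n f g => [|n IHn] f g Cf Cg.
  apply/class_C0P => x Jx.
  have FF : Filter (within J (nbhs x)) by exact: within_filter.
  move/class_C0P : Cf => /(_ x Jx) fx; move/class_C0P : Cg => /(_ x Jx) gx.
  exact: (cvgD (FF:=FF) fx gx).
apply: (class_CS_intro (f' := fun y => derive_on J f y + derive_on J g y)).
  by move=> x Jx; apply: has_derivD; [exact: class_C_has_deriv Cf Jx|
                                      exact: class_C_has_deriv Cg Jx].
by apply: IHn; exact: class_C_derive_on.
Qed.

Lemma class_CM n f g : class_C n J f -> class_C n J g ->
  class_C n J (fun y => f y * g y).
Proof.
elim: n f g => [|n IHn] f g Cf Cg.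
  apply/class_C0P => x Jx.
  have FF : Filter (within J (nbhs x)) by exact: within_filter.
  move/class_C0P : Cf => /(_ x Jx) fx; move/class_C0P : Cg => /(_ x Jx) gx.
  exact: (cvgM (FF:=FF) fx gx).
apply: (class_CS_intro
  (f' := fun y => derive_on J f y * g y + f y * derive_on J g y)).
  by move=> x Jx; apply: (has_derivM Jx); [exact: class_C_has_deriv Cf Jx|
                                             exact: class_C_has_deriv Cg Jx].
have [Cf' Cg'] := (class_C_derive_on Cf, class_C_derive_on Cg).
by apply: class_CD; [exact: IHn Cf' (class_CW Cg)|exact: IHn (class_CW Cf) Cg'].
Qed.

Lemma class_CX n f k : class_C n J f -> class_C n J (fun y => f y ^+ k).
Proof.
move=> Cf; elim: k => [|k IHk]; first exact: class_C_cst.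
by under eq_fun do rewrite exprS; exact: class_CM.
Qed.

Lemma class_C_prod n p (f : 'I_p -> R -> R[i]) :
  (forall j, class_C n J (f j)) -> class_C n J (fun y => \prod_(j < p) f j y).
Proof.
elim: p f => [|p IHp] f Cf.
  by under eq_fun do rewrite big_ord0; exact: class_C_cst.
under eq_fun do rewrite big_ord_recl.
by apply: class_CM; [exact: Cf|exact: IHp].
Qed.

Lemma iter_derive_onD k f g x : class_C k J f -> class_C k J g -> J x ->
  iter k (derive_on J) (fun y => f y + g y) x =
  iter k (derive_on J) f x + iter k (derive_on J) g x.
Proof.
elim: k f g => [//|k IHk] f g Cf Cg Jx; rewrite !iterSr.
rewrite -(IHk _ _ (class_C_derive_on Cf) (class_C_derive_on Cg) Jx).
apply: iter_derive_on_ext => // y Jy; apply: has_deriv_derive_on => //.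
by apply: has_derivD; [exact: class_C_has_deriv Cf Jy|
                       exact: class_C_has_deriv Cg Jy].
Qed.

Lemma class_C_iter m k f : class_C (k + m) J f ->
  class_C m J (iter k (derive_on J) f).
Proof.
elim: k f => [|k IHk] f Cf; [exact: Cf|rewrite iterSr; apply: IHk].
exact: class_C_derive_on.
Qed.

Lemma has_deriv_sum n (F : 'I_n -> R -> R[i]) (F' : 'I_n -> R[i]) x :
  (forall i, has_deriv (F i) x (F' i)) ->
  has_deriv (fun y => \sum_(i < n) F i y) x (\sum_(i < n) F' i).
Proof.
elim: n F F' => [|n IHn] F F' FF'.
  rewrite big_ord0; under eq_fun do rewrite big_ord0; exact: has_deriv_cst.
rewrite big_ord_recl; under eq_fun do rewrite big_ord_recl.
by apply: has_derivD => //; exact: IHn.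
Qed.

Lemma has_derivZ (c : R[i]) f x l : J x -> has_deriv f x l ->
  has_deriv (fun y => c * f y) x (c * l).
Proof.
by move=> Jx fl; have := has_derivM Jx (has_deriv_cst c x) fl; rewrite mul0r add0r.
Qed.

(** * Lagrange coefficients *)

Section LagrangeCoefficients.
Variable psi : R -> R[i].

Definition A_coef n f x : R[i] := (n`!%:R)^-1 * D_pred J psi n f x.

Definition B_coef n u x : R[i] :=
  (n`!%:R)^-1 * iter n (derive_on J) (fun y => psi y ^+ n * u y) x.

Lemma A_coef0 f x : A_coef 0 f x = f x.
Proof. by rewrite /A_coef invr1 mul1r. Qed.

Lemma B_coef0 u x : B_coef 0 u x = u x.
Proof. by rewrite /B_coef /= expr0 invr1 !mul1r. Qed.

Lemma factS_inv n : n.+1%:R * (n.+1`!%:R)^-1 = (n`!%:R)^-1 :> R[i].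
Proof. by rewrite factS natrM invfM mulrA divff ?mul1r // pnatr_eq0. Qed.

(** From [psi^(n+1) D f = psi^n (psi D f)]. *)
Lemma A_coefS n f x : n.+1%:R * A_coef n.+1 f x =
  B_coef n (fun y => psi y * derive_on J f y) x.
Proof.
rewrite /A_coef /B_coef mulrA factS_inv /=.
under eq_fun do rewrite exprSr -mulrA.
by [].
Qed.

Lemma has_deriv_iter n u x : class_C n.+1 J u -> J x ->
  has_deriv (iter n (derive_on J) u) x (iter n.+1 (derive_on J) u x).
Proof.
rewrite -addn1 => Cu Jx; rewrite addn1 iterS.
exact: class_C_has_deriv (class_C_iter Cu) Jx.
Qed.

Lemma has_deriv_A_coef n f x : class_C n J psi -> class_C n.+1 J f -> J x ->
  has_deriv (A_coef n f) x (B_coef n (derive_on J f) x).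
Proof.
rewrite /A_coef /B_coef => Cpsi Cf Jx; apply: (has_derivZ Jx).
case: n Cpsi Cf => [|n] Cpsi Cf.
  rewrite /= expr0 mul1r.
  exact: class_C_has_deriv Cf Jx.
apply: has_deriv_iter Jx; apply: class_CM; first exact: class_CX.
exact: class_C_derive_on Cf.
Qed.

(** From [psi^n (psi u) = psi^(n+1) u]: one more derivative raises the degree. *)
Lemma has_deriv_B_coef n u x : class_C n.+1 J psi -> class_C n.+1 J u -> J x ->
  has_deriv (B_coef n (fun y => psi y * u y)) x (n.+1%:R * B_coef n.+1 u x).
Proof.
move=> Cpsi Cu Jx; rewrite /B_coef mulrA factS_inv; apply: (has_derivZ Jx).
have -> : (fun y => psi y ^+ n.+1 * u y) = (fun y => psi y ^+ n * (psi y * u y)).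
  by apply/funext => y; rewrite exprSr mulrA.
apply: has_deriv_iter Jx; apply: class_CM; first exact: class_CX.
exact: class_CM Cpsi Cu.
Qed.

Lemma B_coefD n u v x : class_C n J psi -> class_C n J u -> class_C n J v -> J x ->
  B_coef n (fun y => u y + v y) x = B_coef n u x + B_coef n v x.
Proof.
move=> Cpsi Cu Cv Jx; rewrite /B_coef -mulrDr; congr (_ * _).
under eq_fun do rewrite mulrDr.
by apply: iter_derive_onD Jx; apply: class_CM; [exact: class_CX|exact: Cu|
                                         exact: class_CX|exact: Cv].
Qed.

Lemma B_coef_ext n u v x : J x -> (forall y, J y -> u y = v y) ->
  B_coef n u x = B_coef n v x.
Proof.
move=> Jx uv; congr (_ * _); apply: iter_derive_on_ext => // y Jy.
by rewrite uv.
Qed.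

(** The coefficient form of [(f u) (phi) D phi = f (phi) (u (phi) D phi)]. In the
    proof, [symm] is the symmetry in [D f] and [u] that lets the differentiated
    identity of degree [n] match [conv_derivM] in degree [n+1]. *)
Lemma B_coefM n f u x : class_C n J psi -> class_C n J f -> class_C n J u -> J x ->
  B_coef n (fun y => f y * u y) x =
  conv (fun k => A_coef k f x) (fun k => B_coef k u x) n.
Proof.
elim/ltn_ind: n f u x => -[|n] IH f u x Cpsi Cf Cu Jx.
  by rewrite /conv big_ord1 B_coef0 A_coef0 B_coef0.
have nz : n.+1%:R != 0 :> R[i] by rewrite pnatr_eq0.
apply: (mulfI nz).
have Cpsi' := class_CW Cpsi.
have Cu' := class_CW Cu.
have Cf' := class_C_derive_on Cf.
have Cpsiu := class_CM Cpsi Cu.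
(* The induction hypothesis with [psi] itself in the role of [f]. *)
have psi_swap m v : (m <= n)%N -> class_C n J v ->
    B_coef m (fun y => psi y * v y) x =
    conv (fun k => A_coef k psi x) (fun k => B_coef k v x) m.
  move=> mn Cv; have Cpsim := class_C_le mn Cpsi'.
  exact: (IH m mn _ _ _ Cpsim Cpsim (class_C_le mn Cv) Jx).
have symm : conv (fun k => B_coef k (derive_on J f) x)
                 (fun k => B_coef k (fun y => psi y * u y) x) n =
            conv (fun k => B_coef k (fun y => psi y * derive_on J f y) x)
                 (fun k => B_coef k u x) n.
  rewrite (eq_conv (b' := conv (fun k => A_coef k psi x) (fun k => B_coef k u x))
    (fun k _ => erefl)); last by move=> m mn; exact: psi_swap.
  rewrite convA; apply: eq_conv => // m mn.
  by rewrite convC -psi_swap.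
rewrite conv_derivM.
(* The middle term is the derivative of the identity of degree [n] for the pair
   [f], [psi u], expanded by the product rule. *)
transitivity (\sum_(k < n.+1)
    (B_coef k (derive_on J f) x * B_coef (n - k) (fun y => psi y * u y) x +
     A_coef k f x * ((n - k).+1%:R * B_coef (n - k).+1 u x))).
  rewrite -(has_deriv_derive_on Jx (has_deriv_B_coef Cpsi (class_CM Cf Cu) Jx)).
  apply: has_deriv_derive_on => //.
  apply: (@has_deriv_ext (fun y => \sum_(k < n.+1)
      A_coef k f y * B_coef (n - k) (fun z => psi z * u z) y)) => // [y Jy|].
    rewrite -[LHS](IH n (ltnSn n) f _ y Cpsi' (class_CW Cf) (class_CW Cpsiu) Jy).
    by apply: B_coef_ext => // z _; rewrite mulrCA.
  apply: has_deriv_sum => k; have kn : (k <= n)%N by rewrite -ltnS.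
  have kSn : (k.+1 <= n.+1)%N by rewrite ltnS.
  have nkn : ((n - k).+1 <= n.+1)%N by rewrite ltnS leq_subr.
  apply: (has_derivM Jx).
    exact: (has_deriv_A_coef (class_C_le kn Cpsi') (class_C_le kSn Cf) Jx).
  exact: (has_deriv_B_coef (class_C_le nkn Cpsi) (class_C_le nkn Cu) Jx).
rewrite big_split /=; congr (_ + _).
apply: (etrans symm); apply: eq_conv => // k _.
by rewrite A_coefS.
Qed.

(** The theorem for two factors. The degree is lowered by [A_coefS], and the
    product rule splits [psi D (f g)] into two products to which [B_coefM]
    applies. *)
Lemma A_coefM n f g x : class_C n J psi -> class_C n J f -> class_C n J g -> J x ->
  A_coef n (fun y => f y * g y) x =
  conv (fun k => A_coef k f x) (fun k => A_coef k g x) n.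
Proof.
case: n => [|n] Cpsi Cf Cg Jx.
  by rewrite /conv big_ord1 !A_coef0.
have nz : n.+1%:R != 0 :> R[i] by rewrite pnatr_eq0.
apply: (mulfI nz); rewrite A_coefS conv_derivM.
have [Cf' Cg'] := (class_C_derive_on Cf, class_C_derive_on Cg).
have [Cpsi0 Cf0 Cg0] := And3 (class_CW Cpsi) (class_CW Cf) (class_CW Cg).
have Cpf := class_CM Cpsi0 Cf'.
have Cpg := class_CM Cpsi0 Cg'.
rewrite (@B_coef_ext _ _ (fun y => g y * (psi y * derive_on J f y) +
                                   f y * (psi y * derive_on J g y))) //.
  rewrite (B_coefD Cpsi0 (class_CM Cg0 Cpf) (class_CM Cf0 Cpg) Jx).
  rewrite (B_coefM Cpsi0 Cg0 Cpf Jx) (B_coefM Cpsi0 Cf0 Cpg Jx) convC.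
  by congr (_ + _); apply: eq_conv => // k _; rewrite A_coefS.
move=> y Jy; rewrite (has_deriv_derive_on Jy
  (has_derivM Jy (class_C_has_deriv Cf Jy) (class_C_has_deriv Cg Jy))).
by rewrite mulrDr; congr (_ + _); [rewrite mulrA mulrC|rewrite mulrCA].
Qed.

(** The cut-off degree [n] is fixed while [m] varies, because the induction on
    the number of factors uses all the coefficients of degree at most [n]. *)
Lemma A_coef_prod n p (f : 'I_p.+1 -> R -> R[i]) m x : (m <= n)%N ->
  class_C n J psi -> (forall j, class_C n J (f j)) -> J x ->
  A_coef m (fun y => \prod_(j < p.+1) f j y) x =
  (\prod_(j < p.+1) \poly_(i < n.+1) A_coef i (f j) x)`_m.
Proof.
move=> mn Cpsi Cf Jx; elim: p f Cf m mn => [|p IHp] f Cf m mn.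
  rewrite big_ord1 coef_poly ltnS mn; congr (A_coef _ _ _).
  by apply/funext => y; rewrite big_ord1.
have Cm h : class_C n J h -> class_C m J h by exact: class_C_le.
pose g y := \prod_(j < p.+1) f (lift ord0 j) y.
have Cg : class_C n J g.
  exact (class_C_prod (fun j => Cf (lift ord0 j))).
have -> : (fun y => \prod_(j < p.+2) f j y) = (fun y => f ord0 y * g y).
  by apply/funext => y; rewrite big_ord_recl.
rewrite (A_coefM (Cm _ Cpsi) (Cm _ (Cf ord0)) (Cm _ Cg) Jx).
rewrite big_ord_recl coefM; apply: eq_bigr => k _.
have kn : (k <= n)%N by rewrite (leq_trans _ mn) // -ltnS.
rewrite coef_poly ltnS kn /g.
rewrite (IHp _ (fun j => Cf (lift ord0 j))) //.
exact: leq_trans (leq_subr _ _) mn.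
Qed.

End LagrangeCoefficients.

End Calculus.

Theorem mainTheorem4 (R : realType) (n : nat) (J : set R)
    (J_interval : is_interval J)
    (J_two_points : exists a b : R, [/\ J a, J b & a <> b]) :
  (forall psi f g : R -> R[i],
     class_C n J psi -> class_C n J f -> class_C n J g ->
     forall x : R, J x ->
       (n`!%:R)^-1 * D_pred J psi n (fun y => f y * g y) x =
       \sum_(k < n.+1)
         ((k`!%:R)^-1 * D_pred J psi k f x) *
         (((n - k)`!%:R)^-1 * D_pred J psi (n - k) g x)) /\
  (forall (p : nat), (2 <= p)%N ->
   forall (psi : R -> R[i]) (f : 'I_p -> R -> R[i]),
     class_C n J psi -> (forall j : 'I_p, class_C n J (f j)) ->
     forall x : R, J x ->
       (n`!%:R)^-1 * D_pred J psi n (fun y => \prod_(j < p) f j y) x =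
       \sum_(alpha : {ffun 'I_p -> 'I_n.+1} | (\sum_(j < p) alpha j == n)%N)
         \prod_(j < p) (((alpha j)`!%:R)^-1 * D_pred J psi (alpha j) (f j) x)).
Proof.
split=> [psi f g Cpsi Cf Cg x Jx|[//|p] _ psi f Cpsi Cf x Jx].
  exact: (A_coefM J_interval J_two_points Cpsi Cf Cg Jx).
rewrite -(coef_prod_poly n (fun j i => A_coef (J:=J) psi i (f j) x)).
exact: (A_coef_prod J_interval J_two_points (leqnn n) Cpsi Cf Jx).
Qed.
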